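(* Let $\Omega$ be a finite set of odd size $n\ge3$. Then: (1) For every $\omega\in\Omega$, the hypergraph $\mathcal{H}_\omega=\{\{\omega\}\}\cup\mathcal{U}_{2,\Omega\setminus\{\omega\}}$ is a domination hypergraph; moreover, for a graph $G$ with vertex set $\Omega$, $\mathcal{D}(G)=\mathcal{H}_\omega$ if and only if $G=K_{\{\omega\}}\vee G'$ where $G'$ is a graph with vertex set $\Omega\setminus\{\omega\}$ and $\mathcal{D}(G')=\mathcal{U}_{2,\Omega\setminus\{\omega\}}$. (2) $\mathcal{U}_{2,\Omega}$ has exactly $n$ minimal domination completions; namely, if $\Omega=\{\omega_1,\dots,\omega_n\}$, the set of minimal domination completions is $\{\mathcal{H}_{\omega_1},\dots,\mathcal{H}_{\omega_n}\}$. (3) For any two distinct $\omega_{i_1},\omega_{i_2}\in\Omega$, $\mathcal{U}_{2,\Omega}=\mathcal{H}_{\omega_{i_1}}\sqcap\mathcal{H}_{\omega_{i_2}}$, so $\{\mathcal{H}_{\omega_{i_1}},\mathcal{H}_{\omega_{i_2}}\}$ is a $2$-decomposition of $\mathcal{U}_{2,\Omega}$. In particular $\mathfrak{D}(2,\Omega)=2$.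
   Context: Graphs are finite, simple, undirected; $\mathcal{D}(G)$ is the family of inclusion-minimal dominating sets of $G$ (a dominating set is $D\subseteq V(G)$ such that every vertex outside $D$ has a neighbour in $D$). A hypergraph on $\Omega$ is a nonempty family of nonempty subsets of $\Omega$, none a proper subset of another; it has ground set $\Omega$ if the union of its members is $\Omega$. A domination hypergraph is one of the form $\mathcal{D}(G)$ for a graph $G$. $\mathcal{U}_{r,X}=\{A\subseteq X:|A|=r\}$. $K_X$ is the complete graph on $X$; the join $G_1\vee G_2$ of graphs with disjoint vertex sets adds all edges between $V(G_1)$ and $V(G_2)$ to $E(G_1)\cup E(G_2)$. $\mathcal{H}_1\leqslant\mathcal{H}_2$ means: for every $A_1\in\mathcal{H}_1$ there is $A_2\in\mathcal{H}_2$ with $A_2\subseteq A_1$. A domination completion of $\mathcal{U}_{r,\Omega}$ is a domination hypergraph with ground set $\Omega$ with $\mathcal{U}_{r,\Omega}\leqslant\mathcal{H}$; minimal ones are the $\leqslant$-minimal such. $\mathcal{H}_1\sqcap\cdots\sqcap\mathcal{H}_\ell$ is the family of inclusion-minimal sets among $\{A_1\cup\cdots\cup A_\ell:A_i\in\mathcal{H}_i\}$. A $t$-decomposition of $\mathcal{U}_{r,\Omega}$ is a family of $t$ distinct domination hypergraphs with ground set $\Omega$ whose $\sqcap$ equals $\mathcal{U}_{r,\Omega}$; $\mathfrak{D}(r,\Omega)$ is the least such $t$. *)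

(* Defs.v *)
From HB Require Import structures.
From mathcomp Require Import all_boot.

Set Implicit Arguments.
Unset Strict Implicit.
Unset Printing Implicit Defensive.

(* A finite simple undirected graph with vertices in the finite type T: a pair
   (vertex set, edge set), the edges being 2-element sets of vertices. *)
Section Graphs.
Variable T : finType.

Definition sgraph_axiom (p : {set T} * {set {set T}}) : bool :=
  [forall e in p.2, (e \subset p.1) && (#|e| == 2)].

Record sgraph := SGraph {
  sgraph_val : {set T} * {set {set T}};
  _ : sgraph_axiom sgraph_val
}.

HB.instance Definition _ := [isSub for sgraph_val].
HB.instance Definition _ := [Finite of sgraph by <:].

Definition vertices (G : sgraph) : {set T} := (sgraph_val G).1.
Definition edges (G : sgraph) : {set {set T}} := (sgraph_val G).2.

Lemma edgesP (G : sgraph) (e : {set T}) :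
  e \in edges G -> e \subset vertices G /\ #|e| = 2.
Proof.
case: G => p Hp; rewrite /edges /vertices /= => He.
by case/andP: (forall_inP Hp e He) => ? /eqP.
Qed.

Definition adjacent (G : sgraph) : rel T := fun u v => [set u; v] \in edges G.

Definition uniform (r : nat) (X : {set T}) : {set {set T}} :=
  [set A : {set T} | (A \subset X) && (#|A| == r)].

Fact complete_graph_subproof (X : {set T}) : sgraph_axiom (X, uniform 2 X).
Proof. by apply/forall_inP => e; rewrite inE. Qed.

Definition complete_graph (X : {set T}) : sgraph :=
  SGraph (complete_graph_subproof X).

(* Meant for disjoint vertex sets, in which case the guard x != y is vacuous;
   it only makes the operation total. *)
Definition join_edges (G1 G2 : sgraph) : {set {set T}} :=
  edges G1 :|: edges G2 :|:
  [set [set x; y] | x in vertices G1, y in vertices G2 & x != y].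

Fact graph_join_subproof (G1 G2 : sgraph) :
  sgraph_axiom (vertices G1 :|: vertices G2, join_edges G1 G2).
Proof.
apply/forall_inP => e /=; rewrite !inE => /orP[/orP[]|].
- case/edgesP => sub ->; rewrite eqxx andbT.
  exact: subset_trans sub (subsetUl _ _).
- case/edgesP => sub ->; rewrite eqxx andbT.
  exact: subset_trans sub (subsetUr _ _).
- case/imset2P => x y xV; rewrite inE => /andP[yV neq] ->.
  by rewrite cards2 neq subUset !sub1set !inE xV yV orbT.
Qed.

Definition graph_join (G1 G2 : sgraph) : sgraph :=
  SGraph (graph_join_subproof G1 G2).

Definition dominating (G : sgraph) (D : {set T}) : bool :=
  (D \subset vertices G) &&
  [forall v in vertices G :\: D, exists u in D, adjacent G v u].

Definition min_dominating_sets (G : sgraph) : {set {set T}} :=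
  [set D : {set T} | minset (dominating G) D].

End Graphs.

Section Hypergraphs.
Variable T : finType.
Implicit Types (Omega : {set T}) (H : {set {set T}}).

Definition hypergraph_on Omega H : bool :=
  [&& H != set0,
      set0 \notin H,
      [forall A in H, A \subset Omega] &
      [forall A in H, forall B in H, ~~ (A \proper B)]].

Definition has_ground_set Omega H : bool := cover H == Omega.

Definition domination_hypergraph Omega H : bool :=
  hypergraph_on Omega H &&
  [exists G : sgraph T, H == min_dominating_sets G].

Definition hyp_le H1 H2 : bool :=
  [forall A1 in H1, exists A2 in H2, A2 \subset A1].

Definition domination_completion (r : nat) Omega H : bool :=
  [&& domination_hypergraph Omega H,
      has_ground_set Omega H &
      hyp_le (uniform r Omega) H].

Definition min_domination_completions (r : nat) Omega : {set {set {set T}}} :=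
  [set H : {set {set T}} |
     domination_completion r Omega H &&
     [forall H' : {set {set T}},
        (domination_completion r Omega H' && hyp_le H' H) ==> (H' == H)]].

Definition hyp_unions (s : seq {set {set T}}) : {set {set T}} :=
  [set \bigcup_i (A : {ffun 'I_(size s) -> {set T}}) i
     | A : {ffun 'I_(size s) -> {set T}}
       & [forall i : 'I_(size s), A i \in nth set0 s i]].

Definition sqcap (s : seq {set {set T}}) : {set {set T}} :=
  [set A : {set T} | minset (fun B => B \in hyp_unions s) A].

Definition decomposition (t r : nat) Omega (F : {set {set {set T}}}) : bool :=
  [&& #|F| == t,
      [forall H in F, domination_hypergraph Omega H && has_ground_set Omega H] &
      sqcap (enum F) == uniform r Omega].

(* The least t such that a t-decomposition exists, as a relation, since the
   existence of some decomposition is itself part of the assertion. *)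
Definition is_decomposition_number (r : nat) Omega (t : nat) : Prop :=
  (exists F, decomposition t r Omega F) /\
  (forall t' F, decomposition t' r Omega F -> t <= t').

Definition cone_hypergraph Omega (w : T) : {set {set T}} :=
  [set w] |: uniform 2 (Omega :\ w).

End Hypergraphs.

(* Main.v *)
Require Import Defs.
From mathcomp Require Import all_boot.

Set Implicit Arguments.
Unset Strict Implicit.
Unset Printing Implicit Defensive.

(** If every pair of vertices of a graph is dominating, then every vertex has
    at most one non-neighbour.  Without a universal vertex, "the non-neighbour
    of x" would be a fixed-point-free involution of the vertex set, so that the
    order would be even.  Hence, for odd order, every completion of U_2 contains
    a singleton {w} and lies above the cone hypergraph H_w.  Conversely, the
    complement of a perfect matching on the even set Omega \ {w} has U_2 as its
    minimal dominating sets, and adding a universal vertex w to a graph adds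
    just {w} to the minimal dominating sets, so H_w is a completion. *)

(** * Fixed-point-free involutions and parity *)

Section FixedPointFreeInvolutions.
Variable T : finType.
Implicit Types (X : {set T}) (f : T -> T).

Definition fpf_involution X f :=
  forall x, x \in X -> [/\ f x \in X, f x != x & f (f x) = x].

Lemma cardsD2 X x y : x \in X -> y \in X -> x != y ->
  #|X| = #|X :\ x :\ y|.+2.
Proof.
move=> xX yX xy; rewrite (cardsD1 x) xX (cardsD1 y) !inE yX andbT.
by rewrite eq_sym xy.
Qed.

(** Deleting one orbit [{x, f x}] removes two elements and leaves a set still preserved by [f], so
    induction on the size applies. *)
Lemma fpf_involution_even X f : fpf_involution X f -> ~~ odd #|X|.
Proof.
have [k] := ubnP #|X|; elim: k X => // k IHk X le_Xk fX.
have [-> | [x xX]] := set_0Vmem X; first by rewrite cards0.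
have [fxX fx_x ffx] := fX x xX.
have xfx : x != f x by rewrite eq_sym.
have cX := cardsD2 xX fxX xfx.
rewrite cX /= negbK; apply: IHk => [|y].
  by move: le_Xk; rewrite cX !ltnS => /ltnW.
rewrite !inE => /and3P[y_fx y_x yX]; have [fyX fy_y ffy] := fX y yX.
split=> //; rewrite fyX andbT; apply/andP; split.
  by apply: contraNneq y_x => fyE; rewrite -ffy fyE ffx.
by apply: contraNneq y_fx => fyE; rewrite -ffy fyE.
Qed.

(** Elements are paired off two at a time: [a] and [b] are swapped, and an involution of the
    remaining set, given by induction, is kept elsewhere. *)
Lemma even_fpf_involution X : ~~ odd #|X| -> exists f, fpf_involution X f.
Proof.
have [k] := ubnP #|X|; elim: k X => // k IHk X le_Xk evX.
have [X0 | [a aX]] := set_0Vmem X; first by exists id => x; rewrite X0 inE.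
have [X0 | [b]] := set_0Vmem (X :\ a).
  by move: evX; rewrite (cardsD1 a) aX X0 cards0.
rewrite !inE => /andP[ba bX]; have ab : a != b by rewrite eq_sym.
have cX := cardsD2 aX bX ab.
have [||f fX] := IHk (X :\ a :\ b).
- by move: le_Xk; rewrite cX !ltnS => /ltnW.
- by move: evX; rewrite cX /= negbK.
exists (fun x => if x == a then b else if x == b then a else f x) => x xX.
have [-> | xa] := eqVneq x a; first by rewrite (negPf ba) eqxx.
have [-> | xb] := eqVneq x b; first by rewrite eqxx.
(* Since [f x] avoids [a] and [b], applying the new map again also reaches its last branch. *)
have [] := fX x; first by rewrite !inE xa xb.
by rewrite !inE => /and3P[/negPf-> /negPf-> ->].
Qed.

End FixedPointFreeInvolutions.

(** * Families of minimal sets *)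

Section MinimalSets.
Variable T : finType.
Implicit Types (X A B : {set T}) (P : pred {set T}).

(** A minimal set has at least [r] elements, so it contains an [r]-subset, which satisfies [P] as
    well and must be the whole set. This serves both dominating sets and the operation [sqcap]. *)
Lemma minset_uniform r X P :
    (forall A, P A -> (A \subset X) && (r <= #|A|)) ->
    (forall A, A \in uniform r X -> P A) ->
  [set A | minset P A] = uniform r X.
Proof.
move=> PX XP; apply/setP=> A; rewrite !inE; apply/idP/idP.
  move=> /minsetP[PA minA]; have /andP[sAX rA] := PX A PA.
  have [B sBA /eqP cB] : exists2 B : {set T}, B \subset A & #|B| == r.
    (* The number of [r]-subsets of [A] is a binomial coefficient, positive because [r <= #|A|]. *)
    move: rA; rewrite -bin_gt0 -cards_draws card_gt0 => /set0Pn[B].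
    by rewrite inE => /andP[sBA cB]; exists B.
  have <- // : B = A.
    by apply: minA => //; apply: XP; rewrite inE cB eqxx (subset_trans sBA).
  by rewrite (subset_trans sBA) // cB /=.
move=> /[dup] UA /andP[sAX /eqP cA]; apply/minsetP; split.
  by apply: XP; rewrite inE.
move=> B /PX/andP[_ rB] sBA; apply/eqP; by rewrite eqEcard sBA cA.
Qed.

Lemma uniformP2 X A :
  reflect (exists x y, [/\ x \in X, y \in X, x != y & A = [set x; y]])
          (A \in uniform 2 X).
Proof.
apply: (iffP idP) => [|[x [y [xX yX xy ->]]]].
  rewrite inE => /andP[sAX /cards2P[x [y [xy AE]]]]; exists x, y.
  by move: sAX; rewrite AE subUset !sub1set => /andP[].
by rewrite inE subUset !sub1set xX yX cards2 xy.
Qed.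

End MinimalSets.

(** * Dominating sets and their minimal members *)

Section Domination.
Variable T : finType.
Implicit Types (G : sgraph T) (D : {set T}) (w x y : T).

Definition universal G w : bool :=
  (w \in vertices G) && [forall x in vertices G :\ w, adjacent G x w].

Lemma sgraph_eq G1 G2 :
  vertices G1 = vertices G2 -> edges G1 = edges G2 -> G1 = G2.
Proof.
case: G1 G2 => [[V1 E1] H1] [[V2 E2] H2].
rewrite /vertices /edges /= => VE EE; apply: val_inj => /=.
by rewrite VE EE.
Qed.

Lemma adjacentC G x y : adjacent G x y = adjacent G y x.
Proof. by rewrite /adjacent setUC. Qed.

Lemma adjacent_vertices G x y :
  adjacent G x y -> [/\ x \in vertices G, y \in vertices G & x != y].
Proof.
case/edgesP; rewrite subUset !sub1set cards2 => /andP[-> ->].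
by case: (x != y).
Qed.

Lemma dominatingP G D :
  reflect (D \subset vertices G /\
           forall x, x \in vertices G -> x \notin D ->
             exists2 u, u \in D & adjacent G x u)
          (dominating G D).
Proof.
apply: (iffP andP) => [[-> domD]|[-> domD]]; split=> //.
  move=> x xV xD; apply/exists_inP; apply: (forall_inP domD).
  by rewrite inE xD.
by apply/forall_inP=> x; rewrite inE => /andP[xD xV]; apply/exists_inP/domD.
Qed.

Lemma dominating_sub G D1 D2 :
  D1 \subset D2 -> D2 \subset vertices G -> dominating G D1 ->
  dominating G D2.
Proof.
move=> s12 s2V /dominatingP[_ dom1]; apply/dominatingP; split=> // x xV xD2.
have [|u uD1 xu] := dom1 x xV; first by apply: contra xD2; apply: subsetP.
by exists u => //; apply: (subsetP s12).
Qed.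

Lemma dominating_set0 G : dominating G set0 -> vertices G = set0.
Proof.
move=> /dominatingP[_ dom0]; apply/eqP/set0Pn=> -[x xV].
by have [|u] := dom0 x xV; rewrite inE.
Qed.

Lemma dominating_set1 G w : dominating G [set w] = universal G w.
Proof.
apply/dominatingP/andP; rewrite sub1set => -[wV domw]; split=> //.
  apply/forall_inP=> x; rewrite !inE => /andP[xw xV].
  by have [|u] := domw x xV; rewrite inE // => /eqP->.
move=> x xV; rewrite inE => xw; exists w; rewrite ?set11 //.
by apply: (forall_inP domw); rewrite !inE xw.
Qed.

Lemma min_dominating_setsP G D :
  D \in min_dominating_sets G -> dominating G D.
Proof. by rewrite inE => /minsetp. Qed.

Lemma sub_min_dominating G D : dominating G D ->
  exists2 D', D' \in min_dominating_sets G & D' \subset D.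
Proof. by move=> /minset_exists[D' ? ?]; exists D'; rewrite ?inE. Qed.

(** The only smaller candidate is the empty set, which dominates only a graph without vertices. *)
Lemma set1_min_dominating G w :
  ([set w] \in min_dominating_sets G) = universal G w.
Proof.
rewrite -dominating_set1; apply/idP/idP=> [/min_dominating_setsP // | domw].
have [D minD] := sub_min_dominating domw.
rewrite subset1 => /orP[/eqP <- // | /eqP D0].
have := min_dominating_setsP minD; rewrite D0 => /dominating_set0 V0.
by have /dominatingP[] := domw; rewrite V0 sub1set inE.
Qed.

(* The non-neighbours of x (with x itself) form a dominating set, and any
   dominating subset of it must contain x. *)
Lemma cover_min_dominating G : cover (min_dominating_sets G) = vertices G.
Proof.
apply/eqP; rewrite eqEsubset; apply/andP; split.
  by apply/bigcupsP=> D /min_dominating_setsP/dominatingP[].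
apply/subsetP=> x xV.
have [|D minD sD] := @sub_min_dominating G [set y in vertices G | ~~ adjacent G x y].
  apply/dominatingP; split; first by apply/subsetP=> y; rewrite inE => /andP[].
  move=> y yV; rewrite inE yV /= negbK adjacentC => yx; exists x => //.
  rewrite inE xV; apply/negP=> /adjacent_vertices[_ _].
  by rewrite eqxx.
apply/bigcupP; exists D => //; apply/negPn/negP=> xD.
have /dominatingP[_ /(_ x xV xD)[u uD]] := min_dominating_setsP minD.
by have := subsetP sD u uD; rewrite inE => /andP[_ /negPf->].
Qed.

(** Without vertices the empty set would be dominating, and a hypergraph excludes it as a member. *)
Lemma domination_hypergraph_vertices G : vertices G != set0 ->
  domination_hypergraph (vertices G) (min_dominating_sets G).
Proof.
move=> V0; apply/andP; split; last by apply/existsP; exists G.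
apply/and4P; split.
- apply: contraNneq V0 => D0.
  by rewrite -cover_min_dominating D0 /cover big_set0.
- by apply: contra V0 => /min_dominating_setsP/dominating_set0->.
- by apply/forall_inP=> D /min_dominating_setsP/dominatingP[].
apply/forall_inP=> A minA; apply/forall_inP=> B minB.
apply/negP; rewrite properEneq => /andP[neqAB sAB].
move: minB; rewrite inE => /minsetP[_ /(_ A (min_dominating_setsP minA) sAB)].
by apply/eqP.
Qed.

(** The graph in [domination_hypergraph] comes with no prescribed vertex set; as minimal dominating
    sets cover the vertices, the ground set determines it. *)
Lemma domination_hypergraph_graph (Omega : {set T}) (H : {set {set T}}) :
    domination_hypergraph Omega H -> has_ground_set Omega H ->
  exists2 G, vertices G = Omega & H = min_dominating_sets G.
Proof.
move=> /andP[_ /existsP[G /eqP->]] /eqP; rewrite cover_min_dominating.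
by exists G.
Qed.

(** * Existence of a universal vertex in odd order *)

Lemma pairs_dominating_universal G :
    odd #|vertices G| ->
    (forall A, A \in uniform 2 (vertices G) -> dominating G A) ->
  exists w, universal G w.
Proof.
move=> oddV dom2; apply/existsP; apply: contraLR oddV.
rewrite negb_exists => /forallP no_univ.
pose non_adj x y := [&& y \in vertices G, y != x & ~~ adjacent G x y].
have non_adj_uniq x y z : x \in vertices G ->
    non_adj x y -> non_adj x z -> y = z.
  move=> xV /and3P[yV yx Nxy] /and3P[zV zx Nxz]; apply/eqP/negPn/negP=> yz.
  (* Two distinct non-neighbours of [x] would form a pair that fails to dominate [x]. *)
  have /dominatingP[_ /(_ x xV)] : dominating G [set y; z].
    by apply: dom2; apply/uniformP2; exists y, z.
  rewrite !inE !(eq_sym x) (negPf yx) (negPf zx) => /(_ isT)[u].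
  by rewrite !inE => /orP[]/eqP->; apply/negP.
(* The default [x] is never reached on vertices: as no vertex is universal, each has a
   non-neighbour. *)
pose f x := odflt x [pick y | non_adj x y].
have non_adj_f x : x \in vertices G -> non_adj x (f x).
  move=> xV; rewrite /f; case: pickP => //= nonex.
  have := no_univ x; rewrite /universal xV negb_forall => /existsP[y].
  rewrite negb_imply !inE adjacentC => /andP[/andP[yx yV] Nxy].
  by have := nonex y; rewrite /non_adj yV yx Nxy.
apply: (@fpf_involution_even _ _ f) => x xV.
have /and3P[fxV fxx Nfx] := non_adj_f x xV; split=> //.
(* Both [f (f x)] and [x] are non-neighbours of [f x], hence equal. *)
apply: (@non_adj_uniq (f x)) => //; first exact: non_adj_f.
by rewrite /non_adj xV eq_sym fxx adjacentC.
Qed.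

(** * Complements of perfect matchings *)

Definition involution_edges (X : {set T}) (f : T -> T) : {set {set T}} :=
  [set [set x; f x] | x in X].

Fact involution_graph_subproof (X : {set T}) (f : T -> T) :
  sgraph_axiom (X, uniform 2 X :\: involution_edges X f).
Proof. by apply/forall_inP => e /=; rewrite !inE => /andP[]. Qed.

(* The complement of the perfect matching whose edges are the orbits of f. *)
Definition involution_graph (X : {set T}) (f : T -> T) : sgraph T :=
  SGraph (involution_graph_subproof X f).

Lemma set2_eq x y z : [set x; y] = [set x; z] -> y = z.
Proof.
move=> E; have /setP/(_ y) := E; have /setP/(_ z) := E; rewrite !inE !eqxx !orbT.
by move=> /orP[/eqP->|/eqP//]; rewrite orbb => /esym/eqP.
Qed.

Lemma involution_graph_adjacent (X : {set T}) f x y :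
    fpf_involution X f -> x \in X -> y \in X ->
  adjacent (involution_graph X f) x y = (y != x) && (y != f x).
Proof.
move=> fX xX yX; rewrite /adjacent !inE subUset !sub1set xX yX /= cards2.
rewrite (eq_sym x) andbC; case: (y != x) => //=; congr (~~ _).
apply/imsetP/eqP=> [[z zX E]|->]; last by exists x.
have [_ _ ffz] := fX z zX.
(* Whichever of [z] and [f z] equals [x], the other one is both [y] and [f x]. *)
have : x \in [set z; f z] by rewrite -E set21.
rewrite !inE => /orP[]/eqP xE; move: E; rewrite xE; first exact: set2_eq.
by rewrite ffz [RHS]setUC => /set2_eq.
Qed.

(** A single vertex fails to dominate its partner under [f]; of two distinct vertices, at most one
    is the partner of a given third vertex, so the other one dominates it. *)
Lemma min_dominating_involution_graph (X : {set T}) f :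
    X != set0 -> fpf_involution X f ->
  min_dominating_sets (involution_graph X f) = uniform 2 X.
Proof.
move=> X0 fX; apply: minset_uniform => [D domD | D].
  have /dominatingP[sDX _] := domD; rewrite sDX /= ltnNge.
  apply/negP; rewrite leq_eqVlt ltnS leqn0 => /orP[/cards1P[x DE]|].
    move: sDX domD; rewrite DE sub1set dominating_set1 => xX.
    have [fxX fxx ffx] := fX x xX.
    move=> /andP[_ /forall_inP/(_ (f x))]; rewrite !inE fxx => /(_ fxX).
    by rewrite involution_graph_adjacent // ffx eqxx andbF.
  rewrite cards_eq0 => /eqP D0; move: domD X0; rewrite D0.
  by move=> /dominating_set0; rewrite /vertices /= => ->; rewrite eqxx.
move=> /uniformP2[x [y [xX yX xy ->]]]; apply/dominatingP; split=> [|z zX].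
  by rewrite subUset !sub1set xX.
rewrite !inE negb_or !(eq_sym z) => /andP[xz yz].
have [xfz | xfz] := eqVneq x (f z).
  exists y; rewrite ?set22 // involution_graph_adjacent // yz -xfz.
  by rewrite eq_sym.
by exists x; rewrite ?set21 // involution_graph_adjacent // xz.
Qed.

(** * Joining a new vertex to a graph *)

Lemma cone_adjacent G w x y : w \notin vertices G ->
    adjacent (graph_join (complete_graph [set w]) G) x y =
  [|| adjacent G x y, (x == w) && (y \in vertices G)
    | (y == w) && (x \in vertices G)].
Proof.
move=> wG; rewrite /adjacent /edges /= /join_edges inE inE.
(* A complete graph on one vertex has no edges. *)
have -> : ([set x; y] \in edges (complete_graph [set w])) = false.
  apply/uniformP2=> -[a [b []]].
  by rewrite !inE => /eqP-> /eqP->; rewrite eqxx.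
rewrite /=; congr (_ || _); apply/imset2P/orP=> [[a b] | ].
  rewrite !inE => /eqP-> /andP[bG wb] E.
  have : w \in [set x; y] by rewrite E set21.
  rewrite !inE => /orP[]/eqP wE; rewrite wE in wb E *.
    by left; rewrite eqxx (set2_eq E).
  by right; move: E; rewrite setUC => /set2_eq->; rewrite eqxx.
case=> /andP[/eqP-> vG].
  exists w y; rewrite ?set11 // inE vG.
  by apply: contraNneq wG => ->.
exists w x; rewrite ?set11 // 1?setUC // inE vG.
by apply: contraNneq wG => ->.
Qed.

(** Avoiding [w], the set [D] must dominate the other vertices within [G]. It is then nonempty
    because [G] has vertices, and any of its elements dominates [w]. *)
Lemma dominating_cone G w D : w \notin vertices G -> vertices G != set0 ->
    w \notin D ->
  dominating (graph_join (complete_graph [set w]) G) D = dominating G D.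
Proof.
move=> wG G0 wD; have wE x : x \in vertices G -> x == w = false.
  by move=> xG; apply: contraNF wG => /eqP<-.
apply/dominatingP/dominatingP=> -[sDV domD].
  have sDG : D \subset vertices G.
    apply/subsetP=> x xD; have := subsetP sDV x xD; rewrite !inE.
    by case/orP=> // /eqP xw; rewrite -xw xD in wD.
  split=> // x xG xD; have [||u uD] := domD x; rewrite ?inE ?xG ?orbT //.
  rewrite cone_adjacent // wE //= => /orP[|/andP[/eqP uw]]; first by exists u.
  by rewrite -uw uD in wD.
split=> [|x]; first by apply: subset_trans sDV (subsetUr _ _).
rewrite !inE => /orP[/eqP-> _ | xG xD]; last first.
  by have [u uD xu] := domD x xG xD; exists u; rewrite // cone_adjacent ?xu.
have [D0 | [u uD]] := set_0Vmem D.
  have /dominating_set0 G0' : dominating G set0.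
    by apply/dominatingP; rewrite -D0.
  by rewrite G0' eqxx in G0.
by exists u; rewrite // cone_adjacent // eqxx (subsetP sDV) ?orbT.
Qed.

Lemma universal_cone G w : w \notin vertices G ->
  universal (graph_join (complete_graph [set w]) G) w.
Proof.
move=> wG; apply/andP; split; first by rewrite !inE eqxx.
apply/forall_inP=> x; rewrite !inE => /andP[/negPf-> /= xG].
by rewrite cone_adjacent // eqxx xG !orbT.
Qed.

(** A minimal dominating set containing [w] must be [{w}], which dominates alone. For sets avoiding
    [w], as for all their subsets, dominating the cone and dominating [G] coincide. *)
Lemma min_dominating_cone G w : w \notin vertices G -> vertices G != set0 ->
  min_dominating_sets (graph_join (complete_graph [set w]) G) =
  [set w] |: min_dominating_sets G.
Proof.
move=> wG G0; have univ := universal_cone wG.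
apply/setP=> D; rewrite in_setU1; have [->|Dw] /= := eqVneq D [set w].
  by rewrite set1_min_dominating univ.
have [wD | wD] := boolP (w \in D).
  transitivity false; last first.
    apply/esym/negP=> /min_dominating_setsP/dominatingP[/subsetP/(_ w wD)].
    by move=> wG'; rewrite wG' in wG.
  apply/negP; rewrite inE => /minsetP[_ /(_ [set w])].
  rewrite dominating_set1 sub1set => /(_ univ wD) E.
  by rewrite E eqxx in Dw.
rewrite !inE; apply/minsetP/minsetP=> -[domD minD].
  split=> [|B domB sBD]; first by rewrite -(dominating_cone wG G0 wD).
  apply: minD => //; rewrite dominating_cone //.
  by apply: contra wD; apply: subsetP.
split=> [|B domB sBD]; first by rewrite dominating_cone.
apply: minD => //; rewrite -(dominating_cone (w := w) wG G0) //.
by apply: contra wD; apply: subsetP.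
Qed.

(** * Splitting off a universal vertex *)

Fact remove_vertex_subproof G w :
  sgraph_axiom (vertices G :\ w, [set e in edges G | w \notin e]).
Proof.
apply/forall_inP=> e /=; rewrite inE => /andP[/edgesP[sV ->] we].
by rewrite subsetD1 sV we.
Qed.

Definition remove_vertex G w : sgraph T := SGraph (remove_vertex_subproof G w).

Lemma universal_eq_cone G w : universal G w ->
  G = graph_join (complete_graph [set w]) (remove_vertex G w).
Proof.
move=> /andP[wV /forall_inP univ].
have wG' : w \notin vertices (remove_vertex G w) by rewrite !inE eqxx.
apply: sgraph_eq; first by rewrite /vertices /= setD1K.
apply/setP=> e; have [/cards2P[x [y [xy ->]]]|e2] := boolP (#|e| == 2);
  last by apply/idP/idP=> /edgesP[_ ce]; rewrite ce in e2.
(* Membership of a pair among the edges is read as adjacency, leaving a case split on which end, if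
   any, is [w]. *)
change (adjacent G x y = adjacent (graph_join (complete_graph [set w])
  (remove_vertex G w)) x y).
rewrite cone_adjacent // {1}/adjacent !inE /adjacent /edges /=.
rewrite inE !inE negb_or !(eq_sym w) -/(edges G) -/(adjacent G x y).
have [xw|xw] := eqVneq x w; have [yw|yw] := eqVneq y w; rewrite /= ?andbF ?orbF.
- by rewrite xw yw eqxx in xy.
- apply/idP/idP=> [/adjacent_vertices[]//|yV].
  by rewrite xw adjacentC univ // !inE yw.
- apply/idP/idP=> [/adjacent_vertices[]//|xV].
  by rewrite yw univ // !inE xw.
by rewrite andbT.
Qed.

End Domination.

(** * Cone hypergraphs as domination hypergraphs *)

Section Cones.
Variables (T : finType) (Omega : {set T}).
Hypotheses (odd_Omega : odd #|Omega|) (Omega_ge3 : 3 <= #|Omega|).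
Implicit Types (G : sgraph T) (H : {set {set T}}) (w x y : T).

Local Notation cone := (cone_hypergraph Omega).

Lemma Omega_neq0 : Omega != set0.
Proof. by rewrite -card_gt0 (ltn_trans _ Omega_ge3). Qed.

Lemma card_OmegaD1 w : w \in Omega -> #|Omega| = #|Omega :\ w|.+1.
Proof. by move=> wO; rewrite (cardsD1 w) wO. Qed.

Lemma OmegaD1_neq0 w : w \in Omega -> Omega :\ w != set0.
Proof.
by move=> wO; rewrite -card_gt0 -ltnS -card_OmegaD1 // ltnW.
Qed.

Lemma set1_notin_uniform2 (X : {set T}) x : [set x] \notin uniform 2 X.
Proof. by rewrite inE cards1 andbF. Qed.

Lemma set1_cone w x : ([set x] \in cone w) = (x == w).
Proof.
rewrite in_setU1 (negPf (set1_notin_uniform2 _ _)) orbF.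
by apply/eqP/eqP=> [/set1_inj|->].
Qed.

Lemma cone_graph w : w \in Omega ->
  exists2 G, vertices G = Omega & min_dominating_sets G = cone w.
Proof.
move=> wO; have := odd_Omega; rewrite (card_OmegaD1 wO) /=.
move=> /even_fpf_involution[f fX].
have wX : w \notin Omega :\ w by rewrite !inE eqxx.
exists (graph_join (complete_graph [set w]) (involution_graph (Omega :\ w) f)).
  by rewrite /vertices /= setD1K.
rewrite min_dominating_cone ?OmegaD1_neq0 //.
by rewrite min_dominating_involution_graph ?OmegaD1_neq0.
Qed.

Lemma cone_domination_hypergraph w : w \in Omega ->
  domination_hypergraph Omega (cone w) && has_ground_set Omega (cone w).
Proof.
move=> /cone_graph[G VG <-]; rewrite /has_ground_set cover_min_dominating VG.
by rewrite eqxx andbT -{1}VG domination_hypergraph_vertices // VG Omega_neq0.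
Qed.

(** The member [{w}] of the cone hypergraph makes [w] universal, so [G] is a cone over the graph
    left by deleting [w]. *)
Lemma min_dominating_eq_cone G w : w \in Omega -> vertices G = Omega ->
  min_dominating_sets G = cone w <->
  exists G', [/\ vertices G' = Omega :\ w,
                 G = graph_join (complete_graph [set w]) G' &
                 min_dominating_sets G' = uniform 2 (Omega :\ w)].
Proof.
move=> wO VG; split=> [DG | [G' [VG' -> DG']]]; last first.
  by rewrite min_dominating_cone ?DG' // VG' ?OmegaD1_neq0 // !inE eqxx.
have univ : universal G w by rewrite -set1_min_dominating DG set1_cone.
have GE := universal_eq_cone univ.
have VG' : vertices (remove_vertex G w) = Omega :\ w.
  by rewrite /vertices /= -/(vertices G) VG.
exists (remove_vertex G w); split=> //.
have wG' : w \notin vertices (remove_vertex G w) by rewrite VG' !inE eqxx.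
move: DG; rewrite {1}GE min_dominating_cone // ?VG' ?OmegaD1_neq0 // => E.
(* Both sides of [E] adjoin [{w}] to a family not containing it, so [{w}] can be cancelled. *)
rewrite -[RHS](@setU1K _ [set w]) ?set1_notin_uniform2 // -/(cone w) -E setU1K //.
by rewrite set1_min_dominating /universal (negPf wG').
Qed.

(** * Minimal completions of U_2 *)

Lemma hyp_le_cone w H : [set w] \in H -> hyp_le (uniform 2 Omega) H ->
  hyp_le (cone w) H.
Proof.
move=> wH /forall_inP leH; apply/forall_inP=> A.
rewrite in_setU1 => /orP[/eqP->|]; first by apply/exists_inP; exists [set w].
rewrite inE subsetD1 => /andP[/andP[sAO _] cA].
by apply: leH; rewrite inE sAO.
Qed.

(** Every pair contains a member of [H], hence is dominating, and odd order yields a universal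
    vertex. This gives the cone below a completion and also rules out decompositions with a single
    member. *)
Lemma domination_hypergraph_set1 H :
    domination_hypergraph Omega H -> has_ground_set Omega H ->
    hyp_le (uniform 2 Omega) H ->
  exists2 w, w \in Omega & [set w] \in H.
Proof.
move=> domH grH /forall_inP leH.
have [G VG HE] := domination_hypergraph_graph domH grH.
have [|A|w univ] := @pairs_dominating_universal _ G; first by rewrite VG.
  rewrite VG => AU; have /exists_inP[B] := leH A AU.
  rewrite HE => /min_dominating_setsP domB sBA; apply: dominating_sub domB => //.
  by move: AU; rewrite VG inE => /andP[].
exists w; first by have /andP[] := univ; rewrite VG.
by rewrite HE set1_min_dominating.
Qed.

Lemma completion_ge_cone H : domination_completion 2 Omega H ->
  exists2 w, w \in Omega & hyp_le (cone w) H.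
Proof.
move=> /and3P[domH grH leH].
have [w wO wH] := domination_hypergraph_set1 domH grH leH.
by exists w; rewrite ?hyp_le_cone.
Qed.

Lemma cone_completion w : w \in Omega -> domination_completion 2 Omega (cone w).
Proof.
move=> wO; rewrite /domination_completion andbA cone_domination_hypergraph //=.
apply/forall_inP=> A; rewrite inE => /andP[sAO cA]; apply/exists_inP.
have [wA | wA] := boolP (w \in A).
  by exists [set w]; rewrite ?set1_cone ?sub1set.
by exists A => //; rewrite in_setU1 inE subsetD1 sAO wA cA orbT.
Qed.

Lemma hyp_le_trans H1 H2 H3 : hyp_le H1 H2 -> hyp_le H2 H3 -> hyp_le H1 H3.
Proof.
move=> /forall_inP le12 /forall_inP le23; apply/forall_inP=> A AH1.
have /exists_inP[B BH2 sBA] := le12 A AH1.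
have /exists_inP[C CH3 sCB] := le23 B BH2.
by apply/exists_inP; exists C => //; apply: subset_trans sBA.
Qed.

(** A member [A] contains some [B] of the other family, which contains some [C] of the first; the
    antichain condition forces [C = A], and so [B = A]. *)
Lemma hyp_le_antisym H1 H2 :
    hypergraph_on Omega H1 -> hypergraph_on Omega H2 ->
  hyp_le H1 H2 -> hyp_le H2 H1 -> H1 = H2.
Proof.
have sub H H' : hypergraph_on Omega H -> hyp_le H H' -> hyp_le H' H ->
    H \subset H'.
  move=> /and4P[_ _ _ /forall_inP anti] /forall_inP le /forall_inP le'.
  apply/subsetP=> A AH.
  have /exists_inP[B BH' sBA] := le A AH.
  have /exists_inP[C CH sCB] := le' B BH'.
  have := forall_inP (anti C CH) A AH; rewrite properE (subset_trans sCB) //=.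
  rewrite negbK => sAC; suff -> : A = B by [].
  by apply/eqP; rewrite eqEsubset sBA (subset_trans sAC).
by move=> H1O H2O le12 le21; apply/eqP; rewrite eqEsubset !sub.
Qed.

Lemma completion_hypergraph r H :
  domination_completion r Omega H -> hypergraph_on Omega H.
Proof. by case/and3P=> /andP[]. Qed.

(** A member of the second cone inside [{w1}] is too small to be a pair, so it is [{w2}]. Distinct
    cones are thus incomparable. *)
Lemma hyp_le_cones w1 w2 : hyp_le (cone w1) (cone w2) -> w1 = w2.
Proof.
move=> /forall_inP/(_ [set w1]); rewrite set1_cone eqxx => /(_ isT)/exists_inP[A].
rewrite in_setU1 => /orP[/eqP->|].
  by rewrite sub1set inE => /eqP.
by rewrite inE => /andP[_ cA] /subset_leq_card; rewrite cards1 (eqP cA).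
Qed.

Lemma min_domination_completions_cones :
  min_domination_completions 2 Omega = [set cone w | w in Omega].
Proof.
apply/setP=> H; rewrite inE; apply/andP/imsetP=> [[cH /forallP minH]|].
  have [w wO leH] := completion_ge_cone cH; exists w => //.
  by have := minH (cone w); rewrite cone_completion // leH => /eqP.
case=> w wO ->; split; first exact: cone_completion.
apply/forallP=> H'; apply/implyP=> /andP[cH' leH'].
have [w' w'O le'] := completion_ge_cone cH'.
(* The completion [H'] lies between [cone w'] and [cone w]. *)
have w'E : w' = w by apply: hyp_le_cones; apply: hyp_le_trans leH'.
rewrite w'E in le'; apply/eqP; apply: hyp_le_antisym leH' le'.
  exact: completion_hypergraph cH'.
exact: completion_hypergraph (cone_completion wO).
Qed.

Lemma card_cones : #|[set cone w | w in Omega]| = #|Omega|.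
Proof.
apply: card_imset => w1 w2 E; apply/eqP.
by rewrite -set1_cone -E set1_cone.
Qed.

(** * Decompositions of U_2 *)

Lemma hyp_unions0 : hyp_unions [::] = [set set0 : {set T}].
Proof.
apply/setP=> A; rewrite inE; apply/imsetP/eqP=> [[F _ ->]|->].
  by rewrite big_ord0.
by exists [ffun=> set0]; rewrite ?inE ?big_ord0 //; apply/forallP=> -[].
Qed.

Lemma hyp_unions1 H : hyp_unions [:: H] = H.
Proof.
apply/setP=> A; apply/imsetP/idP=> [[F]|AH].
  by rewrite inE => /forallP/(_ ord0) FH ->; rewrite big_ord1.
exists [ffun=> A]; last by rewrite big_ord1 ffunE.
by rewrite inE; apply/forallP=> i; rewrite ffunE (ord1 i).
Qed.

Lemma hyp_unions2P H1 H2 A :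
  reflect (exists A1 A2, [/\ A1 \in H1, A2 \in H2 & A = A1 :|: A2])
          (A \in hyp_unions [:: H1; H2]).
Proof.
apply: (iffP imsetP) => [[F]|[A1 [A2 [A1H A2H ->]]]].
  rewrite inE => /forallP FH ->; exists (F ord0), (F ord_max).
  rewrite big_ord_recl big_ord1 (FH ord0) (FH ord_max); split=> //.
  (* The second index of the expanded union and [ord_max] have the same value. *)
  by congr (_ :|: F _); apply: val_inj.
exists [ffun i : 'I_2 => if i == ord0 then A1 else A2]; last first.
  by rewrite big_ord_recl big_ord1 !ffunE.
rewrite inE; apply/forallP=> -[[|[|//]] i2]; by rewrite ffunE.
Qed.

Lemma cone_card w A : w \in Omega -> A \in cone w ->
  (A \subset Omega) && ((A == [set w]) || (2 <= #|A|)).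
Proof.
move=> wO; rewrite in_setU1 inE => /orP[/eqP->|]; first by rewrite sub1set wO eqxx.
by rewrite subsetD1 => /andP[/andP[-> _] /eqP->]; rewrite orbT.
Qed.

(** A union has at least two elements: either one of its parts does, or it is [{w1, w2}]. Conversely
    a pair [A] is a union, taking from each cone [{wi}] if [wi] lies in [A], and [A] itself
    otherwise. *)
Lemma sqcap_cones w1 w2 : w1 \in Omega -> w2 \in Omega -> w1 != w2 ->
  sqcap [:: cone w1; cone w2] = uniform 2 Omega.
Proof.
move=> w1O w2O w12; apply: minset_uniform => [A|A UA].
  move=> /hyp_unions2P[A1 [A2 [/(cone_card w1O)/andP[s1 c1]]]].
  move=> /(cone_card w2O)/andP[s2 c2] ->; rewrite subUset s1 s2 /=.
  case/orP: c1 => [/eqP A1E|c1]; last first.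
    by apply: leq_trans c1 (subset_leq_card (subsetUl _ _)).
  case/orP: c2 => [/eqP A2E|c2]; last first.
    by apply: leq_trans c2 (subset_leq_card (subsetUr _ _)).
  by rewrite A1E A2E cards2 w12.
apply/hyp_unions2P.
have mem_cone w : w \notin A -> A \in cone w.
  move: UA; rewrite in_setU1 !inE subsetD1 => /andP[-> ->] ->.
  by rewrite orbT.
have [w1A|/mem_cone w1A] := boolP (w1 \in A);
  have [w2A|/mem_cone w2A] := boolP (w2 \in A).
- exists [set w1], [set w2]; rewrite !set1_cone !eqxx; split=> //.
  apply/esym/eqP; rewrite eqEcard subUset !sub1set w1A w2A cards2 w12.
  by move: UA; rewrite inE => /andP[_ /eqP->].
- exists [set w1], A; rewrite set1_cone eqxx; split=> //.
  by rewrite setUC; apply/esym/setUidPl; rewrite sub1set.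
- exists A, [set w2]; rewrite set1_cone eqxx; split=> //.
  by apply/esym/setUidPl; rewrite sub1set.
by exists A, A; rewrite setUid.
Qed.

(** A decomposition is a set of hypergraphs listed by [enum], whose order is not known, so both
    orders are allowed for. *)
Lemma enum_set2 (S : finType) (a b : S) : a != b ->
  enum [set a; b] = [:: a; b] \/ enum [set a; b] = [:: b; a].
Proof.
move=> ab; have := enum_uniq [set a; b].
have : size (enum [set a; b]) = 2 by rewrite -cardE cards2 ab.
have := mem_enum [set a; b].
case: (enum _) => [|x [|y [|]]] // mE _ /=; rewrite inE andbT => xy.
have := mE x; have := mE y; rewrite !inE !eqxx orbT /=.
move=> /esym/orP[]/eqP yE /esym/orP[]/eqP xE; move: xy; rewrite xE yE ?eqxx //.
  by right.
by left.
Qed.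

Lemma decomposition_cones w1 w2 : w1 \in Omega -> w2 \in Omega -> w1 != w2 ->
  decomposition 2 2 Omega [set cone w1; cone w2].
Proof.
move=> w1O w2O w12.
have c12 : cone w1 != cone w2.
  by apply: contraNneq w12 => E; rewrite -set1_cone -E set1_cone.
apply/and3P; split; first by rewrite cards2 c12.
  apply/forall_inP=> H; rewrite !inE.
  by case/orP=> /eqP->; apply: cone_domination_hypergraph.
by case: (enum_set2 c12) => ->; rewrite sqcap_cones // eq_sym.
Qed.

(** The empty family has [sqcap] equal to [{set0}]. A single [H] would lie above U_2 and so contain
    a singleton, and a minimal member inside it is too small to be a pair. *)
Lemma decomposition_ge2 t F : decomposition t 2 Omega F -> 2 <= t.
Proof.
case/and3P=> /eqP <- /forall_inP domF /eqP; rewrite cardE.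
have := mem_enum F; case: (enum F) => [|H [|//]] mE sqE.
  have : set0 \in @sqcap T [::].
    rewrite inE hyp_unions0; apply/minsetP; rewrite inE; split=> // B.
    by rewrite inE => /eqP.
  by rewrite sqE inE cards0 andbF.
have /domF/andP[domH grH] : H \in F by rewrite -mE inE.
have leH : hyp_le (uniform 2 Omega) H.
  apply/forall_inP=> A; rewrite -sqE inE hyp_unions1 => /minsetp AH.
  by apply/exists_inP; exists A.
have [w wO wH] := domination_hypergraph_set1 domH grH leH.
have [A minA sAw] := minset_exists (P := fun B => B \in H) wH.
have : A \in sqcap [:: H] by rewrite inE hyp_unions1.
rewrite sqE inE => /andP[_ /eqP cA].
by have := subset_leq_card sAw; rewrite cA cards1.
Qed.

Lemma decomposition_number2 : is_decomposition_number 2 Omega 2.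
Proof.
split; last by move=> t F /decomposition_ge2.
have /set0Pn[w1 w1O] := Omega_neq0.
have /set0Pn[w2] := OmegaD1_neq0 w1O; rewrite !inE eq_sym => /andP[w12 w2O].
by exists [set cone w1; cone w2]; apply: decomposition_cones.
Qed.

End Cones.

Theorem theorem4p2 (T : finType) (Omega : {set T}) (n : nat)
    (card_Omega : #|Omega| = n) (odd_n : odd n) (n_ge3 : 3 <= n) :
  [/\ (* (1) *)
      forall w : T, w \in Omega ->
        domination_hypergraph Omega (cone_hypergraph Omega w) /\
        (forall G : sgraph T, vertices G = Omega ->
           (min_dominating_sets G = cone_hypergraph Omega w <->
            exists G' : sgraph T,
              [/\ vertices G' = Omega :\ w,
                  G = graph_join (complete_graph [set w]) G' &
                  min_dominating_sets G' = uniform 2 (Omega :\ w)])),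
      (* (2) *)
      #|min_domination_completions 2 Omega| = n /\
      min_domination_completions 2 Omega =
        [set cone_hypergraph Omega w | w in Omega] &
      (* (3) *)
      (forall w1 w2 : T, w1 \in Omega -> w2 \in Omega -> w1 != w2 ->
         uniform 2 Omega =
           sqcap [:: cone_hypergraph Omega w1; cone_hypergraph Omega w2] /\
         decomposition 2 2 Omega
           [set cone_hypergraph Omega w1; cone_hypergraph Omega w2]) /\
      is_decomposition_number 2 Omega 2].

Proof.
move: odd_n n_ge3; rewrite -card_Omega => oddO geO; split.
- move=> w wO; split; last by move=> G; apply: min_dominating_eq_cone.
  by case/andP: (cone_domination_hypergraph oddO geO wO).
- by rewrite min_domination_completions_cones // card_cones.
split; last exact: decomposition_number2.
move=> w1 w2 w1O w2O w12.
by rewrite sqcap_cones // decomposition_cones.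
Qed.
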